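(* The graph $GI(7;1,2,3)$ is a unit-distance graph. More precisely, put $R_m=\frac{1}{2\sin(m\pi/7)}$ for $m=1,2,3$, and $\theta_1=0$, $\theta_2=\pi/3$, $\theta_3=-\pi/3$. Placing, for $m\in\{1,2,3\}$ and $v\in\mathbb{Z}_7$, the vertex $(m-1,v)$ at the point $R_m\,(\cos(2\pi v/7+\theta_m),\ \sin(2\pi v/7+\theta_m))$ of the plane gives a drawing of $GI(7;1,2,3)$ in which all edges have length $1$.
   Context: $GI(7;1,2,3)$ is the graph with vertex set $\mathbb{Z}_3\times\mathbb{Z}_7$ and two types of edges: an edge joining $(s,v)$ to $(s',v)$ for all distinct $s,s'\in\mathbb{Z}_3$ and all $v\in\mathbb{Z}_7$; and edges joining $(s,v)$ to $(s,v+j_s)$ and $(s,v-j_s)$ for all $s\in\mathbb{Z}_3$, $v\in\mathbb{Z}_7$, where $j_0=1$, $j_1=2$, $j_2=3$. A graph is a unit-distance graph if it can be drawn in the plane (distinct vertices at distinct points, edges as straight segments) such that all of its edges have the same length. *)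

(* Defs.v *)
From HB Require Import structures.
From mathcomp Require Import all_boot all_order all_algebra.
From mathcomp Require Import all_classical all_reals all_analysis.

Set Implicit Arguments.
Unset Strict Implicit.
Unset Printing Implicit Defensive.

Import Order.TTheory GRing.Theory Num.Theory.
Local Open Scope ring_scope.

(* The library norm on [R * R] is the sup norm, hence this definition. *)
Definition euclid_dist (R : realType) (p q : R * R) : R :=
  Num.sqrt ((p.1 - q.1) ^+ 2 + (p.2 - q.2) ^+ 2).

(* A graph is given by its (symmetric, irreflexive) adjacency relation [e].
   A straight-line drawing is determined by the positions of the vertices, and
   the length of an edge is the distance between the positions of its ends. *)
Definition equilateral_drawing (R : realType) (T : finType) (e : rel T)
    (f : T -> R * R) (l : R) : Prop :=
  injective f /\ forall x y : T, e x y -> euclid_dist (f x) (f y) = l.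

Definition unit_distance_graph (R : realType) (T : finType) (e : rel T) : Prop :=
  exists (f : T -> R * R) (l : R), equilateral_drawing e f l.

Definition GI_step (s : 'Z_3) : 'Z_7 := nth 0 [:: 1; 2; 3] s.

Definition GI_7_1_2_3 : rel ('Z_3 * 'Z_7) := fun x y =>
  (x.1 != y.1) && (x.2 == y.2) ||
  (x.1 == y.1) && ((y.2 == x.2 + GI_step x.1) || (y.2 == x.2 - GI_step x.1)).

Lemma GI_7_1_2_3_sym : symmetric GI_7_1_2_3.
Proof.
move=> [s v] [t w]; rewrite /GI_7_1_2_3 /= [t == s]eq_sym [w == v]eq_sym.
case: eqVneq => [<-|] //=.
by rewrite orbC [w == v - _]eq_sym subr_eq [v == w - _]eq_sym subr_eq.
Qed.

Lemma GI_7_1_2_3_irrefl : irreflexive GI_7_1_2_3.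
Proof.
move=> [s v]; rewrite /GI_7_1_2_3 /= !eqxx /=.
rewrite -{1 3}[v]addr0 !(inj_eq (addrI v)) eq_sym [0 == _]eq_sym oppr_eq0 orbb.
by case: s => [[|[|[|s]]]].
Qed.

Definition GI_radius (R : realType) (m : nat) : R :=
  1 / (2 * sin (m%:R * pi / 7)).

(* Only the values at 1, 2 and 3 matter. *)
Definition GI_phase (R : realType) (m : nat) : R :=
  match m with
  | 1%N => 0
  | 2%N => pi / 3
  | _ => - (pi / 3)
  end.

(* Layer [s] carries the index [m = s + 1]; [v] in the real angle stands for
   its representative in {0, ..., 6}. *)
Definition GI_placement (R : realType) (x : 'Z_3 * 'Z_7) : R * R :=
  let m := (x.1 : nat).+1 in
  let a := 2 * pi * (x.2 : nat)%:R / 7 + GI_phase R m in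
  (GI_radius R m * cos a, GI_radius R m * sin a).

(* Main.v *)
Require Import Defs.
From HB Require Import structures.
From mathcomp Require Import all_boot all_order all_algebra.
From mathcomp Require Import all_classical all_reals all_analysis.
From mathcomp Require Import ring lra zify.
Import Order.TTheory GRing.Theory Num.Theory.
Local Open Scope ring_scope.

(** Each layer lies on a circle centred at the origin, the layer with index
    [m] on the one of radius [R_m = 1 / (2 sin (m pi / 7))], and everything is
    read off from the law of cosines.  Inside a layer, points whose positions
    are [k] steps of [2 pi / 7] apart are at distance [2 R_m |sin (k pi / 7)|],
    which vanishes only for [k] divisible by [7] and is [1] for [k = m] and for
    [k = 7 - m].

    Between two layers, the angle is the difference of the phases, that is
    [pi / 3], [pi / 3] or [2 pi / 3], so the three squared edge lengths are
    [R_1^2 - R_1 R_2 + R_2^2], [R_1^2 - R_1 R_3 + R_3^2] and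
    [R_2^2 + R_2 R_3 + R_3^2].  By the classical relation [R_1 = R_2 + R_3]
    (the reciprocals of the sides of a heptagonal triangle), the three
    expressions agree: geometrically, the [R_m] are the distances from a point
    to the vertices of an equilateral triangle on whose circumcircle it lies
    ([GI_radius_ptolemy]).  The side of that triangle is
    [1] ([GI_radius_eisenstein]).  Both identities are computed in the cubic
    field generated by [2 cos (pi / 7)].

    Points of different layers cannot coincide, since the three radii are
    pairwise distinct. *)

(** * Distances in polar coordinates *)

Lemma law_of_cosines (R : realType) (r q a b : R) :
  (r * cos a - q * cos b) ^+ 2 + (r * sin a - q * sin b) ^+ 2 =
  r ^+ 2 + q ^+ 2 - 2 * r * q * cos (a - b).
Proof.
rewrite cosB; by ring: (cos2sin2 a) (cos2sin2 b).
Qed.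

Lemma chord_sqr (R : realType) (r a b : R) :
  (r * cos a - r * cos b) ^+ 2 + (r * sin a - r * sin b) ^+ 2 =
  (2 * r * sin ((a - b) / 2)) ^+ 2.
Proof.
rewrite law_of_cosines.
have -> : a - b = ((a - b) / 2) *+ 2 by field.
set t := (a - b) / 2; rewrite cos_mulr2n.
have -> : t *+ 2 / 2 = t by field.
by ring: (cos2sin2 t).
Qed.

Lemma polar_radius_inj (R : realType) (r q a b : R) : 0 < r -> 0 < q ->
  (r * cos a, r * sin a) = (q * cos b, q * sin b) -> r = q.
Proof.
move=> r0 q0 [hc hs].
have norm2 (t c : R) : (t * cos c) ^+ 2 + (t * sin c) ^+ 2 = t ^+ 2.
  by ring: (cos2sin2 c).
apply: (pexpIrn (n := 2)); rewrite ?nnegrE ?ltW //.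
by rewrite -(norm2 r a) -(norm2 q b) hc hs.
Qed.

Lemma cos_pi3 (R : realType) : cos (pi / 3 : R) = 1 / 2.
Proof.
have pi0 := pi_gt0 R.
have s0 : 0 < sin (pi / 3 : R) by apply: sin_gt0_pi; lra.
(* The supplement of pi / 3 is its double. *)
have : sin (pi / 3 *+ 2 : R) = sin (pi / 3).
  rewrite (_ : pi / 3 *+ 2 = - (pi / 3) + pi :> R); last by field.
  by rewrite sinDpi sinN opprK.
rewrite sin_mulr2n => h; apply: (mulIf (lt0r_neq0 s0)); lra.
Qed.

Lemma cos_2pi3 (R : realType) : cos (pi / 3 + pi / 3 : R) = - (1 / 2).
Proof.
rewrite (_ : pi / 3 + pi / 3 = - (pi / 3) + pi :> R); last by field.
by rewrite cosDpi cosN cos_pi3.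
Qed.

(** * The three radii *)

Lemma sin_pi7_gt0 (R : realType) (k : nat) :
  (0 < k < 7)%N -> 0 < sin (k%:R * pi / 7 : R).
Proof.
move=> /andP[k0 k7]; have pi0 := pi_gt0 R.
have k0R : (0 : R) < k%:R by rewrite ltr0n.
have k7R : k%:R < 7 :> R by rewrite ltr_nat.
apply: sin_gt0_pi; apply/andP; split; first by rewrite divr_gt0 ?mulr_gt0.
by rewrite ltr_pdivrMr // mulrC ltr_pM2l.
Qed.

Lemma GI_radius_gt0 (R : realType) (m : nat) :
  (0 < m < 7)%N -> 0 < GI_radius R m.
Proof. by move=> hm; rewrite divr_gt0 ?mulr_gt0 ?sin_pi7_gt0. Qed.

Lemma GI_radius_inj (R : realType) (m k : nat) :
  (0 < m < 4)%N -> (0 < k < 4)%N -> GI_radius R m = GI_radius R k -> m = k.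
Proof.
move=> hm hk /eqP; rewrite /GI_radius !div1r (inj_eq invr_inj).
rewrite (inj_eq (mulfI _)) ?pnatr_eq0 // => /eqP h.
have pi0 := pi_gt0 R.
(* Below 4 the angle m pi / 7 is acute, where the sine is injective. *)
have acute (i : nat) : (0 < i < 4)%N ->
    i%:R * pi / 7 \in `[- (pi / 2) : R, pi / 2].
  case/andP=> i0 i4; rewrite in_itv /=.
  have : 0 <= pi * i%:R :> R by rewrite mulr_ge0 // ltW.
  have : pi * i%:R <= pi * 3 :> R by rewrite ler_pM2l // ler_nat.
  lra.
have := sin_inj (acute _ hm) (acute _ hk) h.
move=> /(mulIf (_ : 7^-1 != 0)); rewrite invr_eq0 pnatr_eq0 => /(_ isT).
by move=> /(mulIf (lt0r_neq0 pi0)) /eqP; rewrite eqr_nat => /eqP.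
Qed.

Lemma sin_2pi7 (R : realType) :
  sin (2%:R * pi / 7 : R) = (2 * cos (pi / 7)) * sin (pi / 7).
Proof.
rewrite (_ : 2%:R * pi / 7 = pi / 7 *+ 2 :> R); last by field.
by rewrite sin_mulr2n; ring.
Qed.

Lemma sin_3pi7 (R : realType) :
  sin (3%:R * pi / 7 : R) = ((2 * cos (pi / 7)) ^+ 2 - 1) * sin (pi / 7).
Proof.
rewrite (_ : 3%:R * pi / 7 = pi / 7 *+ 2 + pi / 7 :> R); last by field.
by rewrite sinD sin_mulr2n cos_mulr2n; ring.
Qed.

(** This is the equality of the sines of the supplementary angles [3 pi / 7]
    and [4 pi / 7]: in terms of [x = 2 cos (pi / 7)] they are [x^2 - 1] and
    [x^3 - 2 x] times [sin (pi / 7)]. *)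
Lemma two_cos_pi7_cubic (R : realType) (x := 2 * cos (pi / 7) : R) :
  x ^+ 3 = x ^+ 2 + 2 * x - 1.
Proof.
have s0 : 0 < sin (pi / 7 : R) by rewrite -[pi]mul1r; apply: (@sin_pi7_gt0 R 1).
have : sin (3%:R * pi / 7 : R) = sin ((pi / 7 *+ 2) *+ 2).
  rewrite (_ : (pi / 7 *+ 2) *+ 2 = - (3%:R * pi / 7) + pi :> R); last by field.
  by rewrite sinDpi sinN opprK.
rewrite sin_3pi7 sin_mulr2n sin_mulr2n cos_mulr2n => h.
apply: (mulIf (lt0r_neq0 s0)); rewrite /x; move: h; lra.
Qed.

(** The cubic relation makes [2 cos (pi / 7)] and its square minus one units
    of [Z[2 cos (pi / 7)]], which turns the reciprocals into polynomials. *)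
Lemma GI_radius_polynomial (R : realType) (x := 2 * cos (pi / 7) : R) :
  GI_radius R 2 = GI_radius R 1 * (2 + x - x ^+ 2) /\
  GI_radius R 3 = GI_radius R 1 * (x ^+ 2 - x - 1).
Proof.
have hx : x ^+ 3 = x ^+ 2 + 2 * x - 1 := two_cos_pi7_cubic R.
have s1 : 0 < sin (pi / 7 : R) by rewrite -[pi]mul1r; apply: (@sin_pi7_gt0 R 1).
have := @sin_pi7_gt0 R 2 isT; have := @sin_pi7_gt0 R 3 isT.
rewrite /GI_radius sin_2pi7 sin_3pi7 -/x !mul1r.
clearbody x; rewrite !pmulr_lgt0 // => s3 s2.
have x0 := lt0r_neq0 s2; have x1 := lt0r_neq0 s3; have s0 := lt0r_neq0 s1.
split.
- have -> : 2 + x - x ^+ 2 = x^-1 by apply: (mulIf x0); rewrite mulVf //; ring: hx.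
  by field; rewrite x0 s0.
- have -> : x ^+ 2 - x - 1 = (x ^+ 2 - 1)^-1.
    by apply: (mulIf x1); rewrite mulVf //; ring: hx.
  by field; rewrite s0 x1.
Qed.

Lemma GI_radius_ptolemy (R : realType) :
  GI_radius R 1 = GI_radius R 2 + GI_radius R 3.
Proof. by have [-> ->] := GI_radius_polynomial R; ring. Qed.

Lemma GI_radius_eisenstein (R : realType) :
  GI_radius R 2 ^+ 2 + GI_radius R 2 * GI_radius R 3 + GI_radius R 3 ^+ 2 = 1.
Proof.
have hx := two_cos_pi7_cubic R; have [-> ->] := GI_radius_polynomial R.
move: hx; set x := 2 * cos _; set r := GI_radius R 1; rewrite /= => hx.
have hr : r ^+ 2 * x ^+ 2 = 4 * r ^+ 2 - 1.
  have s0 := lt0r_neq0 (@sin_pi7_gt0 R 1 isT).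
  have -> : x ^+ 2 = 4 - (2 * sin (1%:R * pi / 7)) ^+ 2.
    by rewrite mul1r /x; ring: (cos2sin2 (pi / 7 : R)).
  by rewrite /r /GI_radius; field.
(* Reduced modulo the cubic, the quadratic form in the two polynomial factors
   is 4 - x ^ 2, the square of 2 sin (pi / 7). *)
by ring: hx hr.
Qed.

(** * The drawing *)

(** Distances inside a layer do not depend on the phase. *)
Lemma GI_placement_chord (R : realType) (s : 'Z_3) (v w : 'Z_7) :
  let p := GI_placement R (s, v) in let q := GI_placement R (s, w) in
  (p.1 - q.1) ^+ 2 + (p.2 - q.2) ^+ 2 =
  (2 * GI_radius R (s : nat).+1 *
     sin (((v : nat)%:R - (w : nat)%:R) * pi / 7)) ^+ 2.
Proof.
rewrite /GI_placement /= chord_sqr; congr ((_ * sin _) ^+ 2).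
by field.
Qed.

Lemma GI_placement_inj (R : realType) : injective (@GI_placement R).
Proof.
have radius_gt0 (s : 'Z_3) : 0 < GI_radius R (s : nat).+1.
  by apply: GI_radius_gt0; have : (s < 3)%N := ltn_ord s; move: (nat_of_ord s); lia.
move=> [s v] [t w] /[dup] heq.
move=> /(polar_radius_inj _ _ _ _ _ (radius_gt0 s) (radius_gt0 t)).
move=> /(GI_radius_inj R s.+1 t.+1 (ltn_ord s) (ltn_ord t)) [] /val_inj est.
rewrite -est {t est} in heq *; congr (_, _); apply: val_inj => /=.
have := @GI_placement_chord R s v w; rewrite heq /= !subrr expr0n /= addr0.
move=> /esym/eqP; rewrite sqrf_eq0 mulf_eq0 (negPf (lt0r_neq0 _)) /=; last first.
  by rewrite mulr_gt0.
have : (v < 7)%N := ltn_ord v; have : (w < 7)%N := ltn_ord w.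
move: (v : nat) (w : nat) => {v w heq} v w.
wlog vw : v w / (w <= v)%N => [IH hw hv hs|w7 v7].
  case/orP: (leq_total w v) => h; first exact: IH.
  by symmetry; apply: IH => //; rewrite -opprB !mulNr sinN oppr_eq0.
rewrite -natrB // => /eqP hs; apply/eqP; rewrite eqn_leq vw andbT leqNgt.
apply/negP => wv; have : 0 < sin ((v - w)%:R * pi / 7 : R).
  by apply: sin_pi7_gt0; lia.
by rewrite hs ltxx.
Qed.

(** Reducing modulo [7] leaves a step of size [m] up to sign, or of size
    [7 - m], whose half-angle is supplementary. *)
Lemma sin_sqr_step (R : realType) (m v w : nat) :
  [|| w == v + m, v == w + m, w + 7 == v + m | v + 7 == w + m]%N ->
  sin ((v%:R - w%:R) * pi / 7 : R) ^+ 2 = sin (m%:R * pi / 7) ^+ 2.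
Proof.
have cast (i j k l : nat) :
    (i + j = k + l)%N -> i%:R + j%:R = k%:R + l%:R :> R.
  by rewrite -!natrD => ->.
case/or4P=> /eqP h.
- by rewrite h natrD opprD addNKr !mulNr sinN sqrrN.
- by rewrite h natrD addrAC subrr add0r.
- have -> : v%:R - w%:R = 7 - m%:R :> R by have := cast _ _ _ _ h; lra.
  rewrite (_ : (7 - m%:R) * pi / 7 = - (m%:R * pi / 7) + pi); last by field.
  by rewrite sinDpi sinN opprK.
- have -> : v%:R - w%:R = m%:R - 7 :> R by have := cast _ _ _ _ h; lra.
  rewrite (_ : (m%:R - 7) * pi / 7 = - (- (m%:R * pi / 7) + pi)); last by field.
  by rewrite sinN sqrrN sinDpi sinN opprK.
Qed.

Lemma GI_layer_edge_val (s : 'Z_3) (v w : 'Z_7) (m := (s : nat).+1) :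
  (w == v + GI_step s) || (w == v - GI_step s) ->
  [|| w == v + m :> nat, v == w + m :> nat, w + 7 == v + m :> nat
    | v + 7 == w + m :> nat]%N.
Proof.
rewrite {}/m; case: s => [[|[|[|//]]] ?];
  case: v => [[|[|[|[|[|[|[|//]]]]]]] ?];
  by case: w => [[|[|[|[|[|[|[|//]]]]]]] ?].
Qed.

Lemma GI_spoke_length (R : realType) (s t : 'Z_3) (v : 'Z_7) : s != t ->
  euclid_dist (GI_placement R (s, v)) (GI_placement R (t, v)) = 1.
Proof.
have sym (p q : R * R) : euclid_dist p q = euclid_dist q p.
  by rewrite /euclid_dist -sqrrN opprB -[X in _ + X]sqrrN opprB.
wlog lt_st : s t / (s < t)%N => [IH nst|_].
  have /orP[] : (s < t)%N || (t < s)%N by rewrite -neq_ltn.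
    by move=> h; apply: IH.
  by move=> h; rewrite sym; apply: IH => //; rewrite eq_sym.
have e := GI_radius_ptolemy R; have n := GI_radius_eisenstein R.
rewrite /euclid_dist /GI_placement /= law_of_cosines.
rewrite opprD addrACA subrr add0r.
rewrite -[RHS]sqrtr1; congr Num.sqrt.
move: s t lt_st => [[|[|[|//]]] ?] [[|[|[|//]]] ?] //= _.
- by rewrite add0r cosN cos_pi3 e -[RHS]n; field.
- by rewrite add0r opprK cos_pi3 e -[RHS]n; field.
- by rewrite opprK cos_2pi3 -[RHS]n; field.
Qed.

Lemma GI_layer_edge_length (R : realType) (s : 'Z_3) (v w : 'Z_7) :
  (w == v + GI_step s) || (w == v - GI_step s) ->
  euclid_dist (GI_placement R (s, v)) (GI_placement R (s, w)) = 1.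
Proof.
move=> /GI_layer_edge_val /(sin_sqr_step R) hs.
rewrite /euclid_dist GI_placement_chord exprMn hs -exprMn.
rewrite -[RHS]sqrtr1; congr Num.sqrt.
have hm : (0 < (s : nat).+1 < 7)%N by have : (s < 3)%N := ltn_ord s; move: (nat_of_ord s); lia.
by rewrite /GI_radius; field; rewrite lt0r_neq0 // sin_pi7_gt0.
Qed.

Theorem mainTheorem7 (R : realType) :
  unit_distance_graph R GI_7_1_2_3 /\
  equilateral_drawing GI_7_1_2_3 (@GI_placement R) 1.
Proof.
have drawing : equilateral_drawing GI_7_1_2_3 (@GI_placement R) 1.
  split; first exact: GI_placement_inj.
  move=> [s v] [t w] /orP[] /= /andP[].
  - by move=> nst /eqP <-; apply: GI_spoke_length.
  - by move=> /eqP <-; apply: GI_layer_edge_length.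
by split=> //; exists (@GI_placement R), 1.
Qed.
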